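(* Let $n \geq 2$ be an integer. If $n$ is even, then $\mathrm{ParseWords}(\mathrm{LeftCombTree}(n), \mathrm{RightCombTree}(n)) = \{0 1^{n-2} 2\}$. If $n$ is odd (so $n \geq 3$), then $\mathrm{ParseWords}(\mathrm{LeftCombTree}(n), \mathrm{RightCombTree}(n)) = \{0 1^{n-2} 0\}$. (Here sets of equivalence classes are written by listing one representative of each class.)
   Context: A binary tree is a rooted ordered tree in which each vertex has either $0$ or $2$ children; its leaves are ordered left to right. Let $G$ be the context-free grammar with start symbols $0,1,2$ and rules $0\to 12$, $0\to 21$, $1\to 02$, $1\to 20$, $2\to 01$, $2\to 10$. An $n$-leaf binary tree $T$ parses a word $w$ of length $n$ on $\{0,1,2\}$ if there is a labeling of the vertices of $T$ by $0,1,2$ such that the leaves, from left to right, are labeled with the letters of $w$, and at every internal vertex the label of the vertex together with the labels of its left and right children form a rule of $G$ (i.e. the three labels are pairwise distinct). If $T$ parses $w$, it also parses every word obtained from $w$ by permuting the alphabet $\{0,1,2\}$. For $n$-leaf binary trees $T_1,T_2$, $\mathrm{ParseWords}(T_1,T_2)$ denotes the set of equivalence classes (under permutations of the alphabet $\{0,1,2\}$) of words parsed by both $T_1$ and $T_2$; it is written by listing one representative of each class. The level of a vertex is its distance from the root. A path tree is a binary tree with at most two vertices on each level. For $n\ge 2$, $n$-leaf path trees correspond bijectively to words $x_1\cdots x_{n-2}$ on $\{l,r\}$: $x_j=l$ (resp. $x_j=r$) means that, of the two vertices on level $j$, the left (resp. right) one has children. $\mathrm{LeftCombTree}(n)$ is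 the $n$-leaf path tree corresponding to $l^{n-2}$, and $\mathrm{RightCombTree}(n)$ is the $n$-leaf path tree corresponding to $r^{n-2}$. *)

(* Defs.v *)
From mathcomp Require Import all_boot perm.
From mathcomp Require Import classical_sets.
From mathcomp Require Import zify.

Set Implicit Arguments.
Unset Strict Implicit.
Unset Printing Implicit Defensive.

Local Open Scope classical_set_scope.

Inductive bintree : Type := Leaf | Node of bintree & bintree.

Fixpoint num_leaves (T : bintree) : nat :=
  if T is Node T1 T2 then num_leaves T1 + num_leaves T2 else 1.

Fixpoint num_level (T : bintree) (j : nat) {struct j} : nat :=
  match j, T with
  | 0, _ => 1
  | _.+1, Leaf => 0
  | i.+1, Node T1 T2 => num_level T1 i + num_level T2 i
  end.

Inductive dir : Type := L | R.

(* A vertex is addressed by the list of turns leading to it from the root, so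
   that the length of the address is the level of the vertex. *)
Definition vertex := seq dir.

Definition letter : finType := 'I_3.
Definition a0 : letter := @Ordinal 3 0 isT.
Definition a1 : letter := @Ordinal 3 1 isT.
Definition a2 : letter := @Ordinal 3 2 isT.

Definition word := seq letter.

(* (a, b, c) stands for the rule a -> b c. *)
Definition grammar_rules : seq (letter * letter * letter) :=
  [:: (a0, a1, a2); (a0, a2, a1);
      (a1, a0, a2); (a1, a2, a0);
      (a2, a0, a1); (a2, a1, a0)].

(* A labeling of T is any function on addresses; only its values at the
   vertices of T are ever used. Restricting it to the left (right) subtree is
   precomposition with cons L (cons R). *)
Definition labeling := vertex -> letter.

Fixpoint leaf_word (T : bintree) (lab : labeling) : word :=
  match T with
  | Leaf => [:: lab [::]]
  | Node T1 T2 =>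
      leaf_word T1 (lab \o cons L) ++ leaf_word T2 (lab \o cons R)
  end.

Fixpoint obeys_grammar (T : bintree) (lab : labeling) : bool :=
  match T with
  | Leaf => true
  | Node T1 T2 =>
      [&& (lab [::], lab [:: L], lab [:: R]) \in grammar_rules,
          obeys_grammar T1 (lab \o cons L)
        & obeys_grammar T2 (lab \o cons R)]
  end.

Definition parses (T : bintree) (w : word) : Prop :=
  exists2 lab : labeling, obeys_grammar T lab & leaf_word T lab = w.

Definition word_class (w : word) : set word :=
  [set v | exists s : {perm letter}, v = map s w].

Definition ParseWords (T1 T2 : bintree) : set (set word) :=
  [set C | exists w, [/\ parses T1 w, parses T2 w & C = word_class w]].

Definition is_path_tree (T : bintree) : Prop := forall j, num_level T j <= 2.

(* The tree of the word x_1 ... x_(n-2): the vertex with children on level j is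
   the left one if x_j = L and the right one if x_j = R. The two vertices on
   the last level are leaves. *)
Fixpoint path_tree (x : seq dir) : bintree :=
  match x with
  | [::] => Node Leaf Leaf
  | L :: y => Node (path_tree y) Leaf
  | R :: y => Node Leaf (path_tree y)
  end.

Definition LeftCombTree (n : nat) : bintree := path_tree (nseq (n - 2) L).
Definition RightCombTree (n : nat) : bintree := path_tree (nseq (n - 2) R).

Lemma grammar_rulesE (a b c : letter) :
  ((a, b, c) \in grammar_rules) = [&& a != b, a != c & b != c].
Proof.
by case: a b c => [[|[|[|//]]] ?] [[|[|[|//]]] ?] [[|[|[|//]]] ?].
Qed.

Lemma num_leaves_path_tree (x : seq dir) :
  num_leaves (path_tree x) = (size x).+2.
Proof. by elim: x => [|[] x IH] //=; rewrite IH; lia. Qed.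

Lemma path_tree_inj : injective path_tree.
Proof.
elim=> [|[] x IH] [|[] y] //=.
- by case: y => [|[]].
- by case: y => [|[]].
- by case: x {IH} => [|[]].
- by case=> /IH ->.
- by case: x {IH} => [|[]].
- by case: x {IH} => [|[]].
- by case: x {IH} => [|[]].
- by case=> /IH ->.
Qed.

Lemma num_leaves_gt0 (T : bintree) : 0 < num_leaves T.
Proof. by elim: T => //= T1 IH1 T2 IH2; lia. Qed.

Lemma is_path_treeP (T : bintree) :
  2 <= num_leaves T -> is_path_tree T <-> exists x, T = path_tree x.
Proof.
move=> T2; split=> [|[x ->]]; last first.
  elim: x => [|d x IH] j; first by move: j => [|[|[|j]]].
  move: j => [|j] //; have := IH j; case: j => [|j].
    by case: d.
  by case: d => /=; lia.
elim: T T2 => // T1 IH1 T2 IH2 _ pT.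
case: T1 IH1 pT => [|T11 T12] IH1 pT; case: T2 IH2 pT => [|T21 T22] IH2 pT.
- by exists [::].
- have [||x ->] := IH2; last by exists (R :: x).
    by have := num_leaves_gt0 T21; have := num_leaves_gt0 T22; rewrite /=; lia.
  by case=> [|j] //; have := pT j.+2; rewrite /=; lia.
- have [||x ->] := IH1; last by exists (L :: x).
    by have := num_leaves_gt0 T11; have := num_leaves_gt0 T12; rewrite /=; lia.
  by case=> [|j] //; have := pT j.+2; rewrite /=; lia.
- by have := pT 2; case: T11 T12 T21 T22 {IH1 IH2 pT} => [|? ?] [|? ?] [|? ?] [|? ?].
Qed.

(* Main.v *)
(** Identify the letters with the nonzero elements of the Klein four-group, so
    that a rule a -> b c says a = b + c and every vertex is labeled with the sum
    of the leaves below it: a tree parses a word iff all these sums are nonzero.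
    If both combs parse w, then all its proper prefix sums are nonzero and differ
    from the total c. Two values remain, consecutive prefix sums differ, hence
    they alternate, and every inner letter is their difference c. *)
Require Import Defs.
From mathcomp Require Import all_boot perm ssralg.
From mathcomp Require Import classical_sets.

Set Implicit Arguments.
Unset Strict Implicit.
Unset Printing Implicit Defensive.

Import GRing.Theory.
Local Open Scope classical_set_scope.

(** * Letters as nonzero elements of the Klein four-group *)

Definition klein (x : letter) : bool * bool := (0 < x, x != 1 :> nat).

(** The zero vector represents no letter; it gets the default value [a0]. *)
Definition unklein (v : bool * bool) : letter :=
  if v.1 then if v.2 then a2 else a1 else a0.

Lemma kleinK : cancel klein unklein.
Proof. by case=> [[|[|[|//]]] ?]; apply: val_inj. Qed.

Lemma unkleinK (v : bool * bool) : v != 0%R -> klein (unklein v) = v.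
Proof. by case: v => [[] []]. Qed.

Lemma klein_neq0 (x : letter) : klein x != 0%R.
Proof. by case: x => [[|[|[|//]]] ?]. Qed.

Lemma klein_addrr (v : bool * bool) : (v + v = 0)%R.
Proof. by case: v => [[] []]. Qed.

Lemma klein_addr_eq0 (u v : bool * bool) : (u + v == 0)%R = (u == v).
Proof. by case: u v => [[] []] [[] []]. Qed.

Lemma grammar_rules_klein (a b c : letter) :
  ((a, b, c) \in grammar_rules) = (klein a == klein b + klein c)%R.
Proof.
by case: a b c => [[|[|[|//]]] ?] [[|[|[|//]]] ?] [[|[|[|//]]] ?].
Qed.

(** For [a != c] this is the remaining letter; for [a = c] the sum is zero and the value is a
    default. *)
Definition third (a c : letter) : letter := unklein (klein a + klein c)%R.

Lemma klein_third (a c : letter) :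
  a != c -> klein (third a c) = (klein a + klein c)%R.
Proof.
move=> ac; apply: unkleinK.
by rewrite klein_addr_eq0 (inj_eq (can_inj kleinK)).
Qed.

Lemma third_neq (a c : letter) : a != c -> third a c != c.
Proof. by case: a c => [[|[|[|//]]] ?] [[|[|[|//]]] ?]. Qed.

Lemma thirdK (a c : letter) : a != c -> third (third a c) c = a.
Proof.
move=> ac; rewrite [LHS]/third klein_third // -addrA klein_addrr addr0.
exact: kleinK.
Qed.

(** * Parsing expressed by leaf sums *)

Definition wsum (w : word) : bool * bool := (\sum_(x <- w) klein x)%R.

Lemma wsum_cons (x : letter) (w : word) : wsum (x :: w) = (klein x + wsum w)%R.
Proof. exact: big_cons. Qed.

Lemma wsum_cat (u v : word) : wsum (u ++ v) = (wsum u + wsum v)%R.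
Proof. exact: big_cat. Qed.

Lemma wsum1 (x : letter) : wsum [:: x] = klein x.
Proof. exact: big_seq1. Qed.

Lemma wsum_leaf_word (T : bintree) (lab : labeling) :
  obeys_grammar T lab -> wsum (leaf_word T lab) = klein (lab [::]).
Proof.
elim: T lab => [|T1 IH1 T2 IH2] lab /=; first by rewrite wsum1.
rewrite grammar_rules_klein => /and3P[/eqP -> o1 o2].
by rewrite wsum_cat IH1 // IH2.
Qed.

Lemma parses_Leaf (w : word) : parses Leaf w <-> size w = 1.
Proof.
split=> [[lab _ <-] //|]; case: w => [|x [|]] // _.
by exists (fun=> x).
Qed.

(** The label of each root is forced to be the sum of the leaves below it, so labelings of the two
    subtrees glue together exactly when the total is the value of a letter. *)
Lemma parses_Node (T1 T2 : bintree) (w : word) :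
  parses (Node T1 T2) w <->
  exists w1 w2, [/\ w = w1 ++ w2, parses T1 w1, parses T2 w2 & wsum w != 0%R].
Proof.
split=> [[lab ob <-]|[w1 [w2 [-> [l1 o1 e1] [l2 o2 e2] s0]]]].
  have /= /and3P[_ o1 o2] := ob.
  exists (leaf_word T1 (lab \o cons L)), (leaf_word T2 (lab \o cons R)).
  split=> //; [by exists (lab \o cons L)|by exists (lab \o cons R)|].
  by rewrite (wsum_leaf_word ob) klein_neq0.
exists (fun v => match v with
                 | [::] => unklein (wsum (w1 ++ w2))
                 | L :: u => l1 u
                 | R :: u => l2 u
                 end); last by rewrite /= -e1 -e2.
apply/and3P; split=> //.
rewrite grammar_rules_klein unkleinK // wsum_cat -e1 -e2.
by rewrite !wsum_leaf_word.
Qed.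

(** * Words parsed by a single comb *)

Lemma path_tree_nseqL (m : nat) :
  path_tree (nseq m L) = iter m.+1 (Node^~ Leaf) Leaf.
Proof. by elim: m => //= m ->. Qed.

Lemma path_tree_nseqR (m : nat) :
  path_tree (nseq m R) = iter m.+1 (Node Leaf) Leaf.
Proof. by elim: m => //= m ->. Qed.

(** The leaves below the spine vertices of a right comb form the nonempty suffixes of the word; for
    a left comb they form the nonempty prefixes. *)
Lemma parses_right_comb (m : nat) (w : word) :
  parses (iter m (Node Leaf) Leaf) w <->
  size w = m.+1 /\ forall i, i <= m -> wsum (drop i w) != 0%R.
Proof.
elim: m w => [|m IH] w.
  rewrite parses_Leaf; split=> [|[]] //; case: w => [|x [|]] // _.
  by split=> // -[] // _; rewrite drop0 wsum1 klein_neq0.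
rewrite iterS parses_Node; split=> [[w1 [w2 [-> ]]]|].
  move=> /parses_Leaf; case: w1 => [|x [|]] //= _ /IH [-> s2] s0.
  by split=> // -[|i] //; apply: s2.
case: w => [|x w] [] //= [sw s0].
exists [:: x], w; split=> //; first exact/parses_Leaf.
- by apply/IH; split=> // i; apply: (s0 i.+1).
- exact: (s0 0).
Qed.

Lemma parses_left_comb (m : nat) (w : word) :
  parses (iter m (Node^~ Leaf) Leaf) w <->
  size w = m.+1 /\ forall i, i <= m -> wsum (take i.+1 w) != 0%R.
Proof.
elim: m w => [|m IH] w.
  rewrite parses_Leaf; split=> [|[]] //; case: w => [|x [|]] // _.
  by split=> // -[] // _; rewrite wsum1 klein_neq0.
rewrite iterS parses_Node; split=> [[w1 [w2 [-> ]]]|].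
  move=> /IH [sw1 s1] /parses_Leaf sw2 s0; rewrite size_cat sw1 sw2 addn1.
  split=> // i; rewrite leq_eqVlt => /predU1P[->|lim].
    by rewrite take_oversize // size_cat sw1 sw2 addn1.
  by rewrite takel_cat ?sw1 //; apply: s1.
case/lastP: w => [|w x] [] //; rewrite size_rcons => -[sw] s0.
exists w, [:: x]; rewrite cats1; split=> //; last 2 first.
- exact/parses_Leaf.
- by have := s0 m.+1 (leqnn _); rewrite take_oversize // size_rcons sw.
apply/IH; split=> // i im; have := s0 i (leqW im).
by rewrite -cats1 takel_cat // sw.
Qed.

(** * Words parsed by both combs *)

(** The last letter is the one that makes the total equal to [klein c]: the inner letters contribute
    [klein c] if [m] is odd and cancel if [m] is even. *)
Definition comb_word (m : nat) (a c : letter) : word :=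
  a :: nseq m c ++ [:: if odd m then a else third a c].

(* The letter a stands for the sum of the prefix already read. *)
Lemma prefix_sums_alternate (m : nat) (a c : letter) (u : word) :
  a != c -> size u = m.+1 ->
  (wsum (a :: u) = klein c /\
   forall i, i <= m ->
     wsum (a :: take i u) != 0%R /\ wsum (a :: take i u) != klein c) <->
  u = nseq m c ++ [:: if odd m then a else third a c].
Proof.
elim: m a u => [|m IH] a [|x u] // ac [].
  case: u => // _; rewrite wsum_cons wsum1; split=> [[tot _]|[->]].
    by rewrite /= /third -tot addrA klein_addrr add0r kleinK.
  rewrite klein_third // addrA klein_addrr add0r.
  split=> // -[] // _.
  by rewrite wsum1 klein_neq0 (inj_eq (can_inj kleinK)).
move=> su.
(* Reading [c] turns the prefix sum [a] into [third a c], so the induction hypothesis is applied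
   with [third a c] as the letter already read. *)
have step v : wsum [:: a, c & v] = wsum (third a c :: v).
  by rewrite !wsum_cons klein_third // addrA.
have {}IH := IH _ _ (third_neq ac) su.
have -> : nseq m.+1 c ++ [:: if odd m.+1 then a else third a c] =
  c :: nseq m c ++ [:: if odd m then third a c else third (third a c) c].
  by rewrite thirdK //=; case: odd.
split=> [[tot pre]|[-> eu]].
  (* The new prefix sum is nonzero, so [x] is not [a], and it differs from [klein c], so [x] is not
     [third a c]. *)
  have xc : x = c.
    have /= [] := pre 1 isT; rewrite take0 wsum_cons wsum1.
    by move: ac; clear; case: a x c => [[|[|[|//]]] ?] [[|[|[|//]]] ?]
      [[|[|[|//]]] ?] //= *; apply: val_inj.
  move: tot pre; rewrite xc step => tot pre; congr cons.
  apply/IH; split=> // i im.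
  by rewrite -step; apply: (pre i.+1).
have [tot pre] := IH.2 eu; rewrite step; split=> // -[_|i im] /=.
  by rewrite wsum1 klein_neq0 (inj_eq (can_inj kleinK)).
by rewrite step; apply: pre.
Qed.

Lemma parses_both_combs (m : nat) (w : word) :
  parses (iter m.+1 (Node^~ Leaf) Leaf) w /\
  parses (iter m.+1 (Node Leaf) Leaf) w <->
  exists a c, a != c /\ w = comb_word m a c.
Proof.
rewrite parses_left_comb parses_right_comb; split.
  move=> [[sw pre] [_ suf]]; case: w sw pre suf => [|a u] // [su] pre suf.
  have tot0 : wsum (a :: u) != 0%R by apply: (suf 0).
  pose c := unklein (wsum (a :: u)).
  have totc : wsum (a :: u) = klein c by rewrite unkleinK.
  (* A proper prefix whose sum equals the total would leave a suffix of sum zero. *)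
  have prec i : i <= m -> wsum (a :: take i u) != klein c.
    move=> im; apply: contraNneq (suf i.+1 im) => /= e.
    rewrite -totc -{2}(cat_take_drop i u) -cat_cons wsum_cat in e.
    by apply/eqP/(addrI (wsum (a :: take i u))); rewrite addr0.
  have ac : a != c.
    have := prec 0 isT; rewrite take0 wsum1.
    by rewrite (inj_eq (can_inj kleinK)).
  exists a, c; split=> //; congr cons; apply/prefix_sums_alternate => //.
  by split=> // i im; split; [apply: (pre i (leqW im))|apply: prec].
move=> [a [c [ac ->]]]; rewrite /comb_word.
set u := nseq m c ++ _.
have su : size u = m.+1 by rewrite size_cat size_nseq addn1.
have [tot pre] := (prefix_sums_alternate ac su).2 erefl.
split; split; rewrite /= ?su //.
  move=> i; rewrite leq_eqVlt => /predU1P[->|im] /=.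
    by rewrite take_oversize ?su // tot klein_neq0.
  by have [] := pre i im.
move=> [_|i im]; first by rewrite tot klein_neq0.
have [_] := pre i im; apply: contraNneq => /= e.
by rewrite -tot -{2}(cat_take_drop i u) -cat_cons wsum_cat e addr0.
Qed.

(** * Equivalence under permutations of the alphabet *)

Lemma comb_word_perm (m : nat) (a c : letter) (ac : a != c) :
  exists s : {perm letter}, comb_word m a c = map s (comb_word m a0 a1).
Proof.
(* The map sends [a0], [a1], [a2] to [a], [c], [third a c], which are distinct since [a != c]. *)
pose f (x : letter) := nth a0 [:: a; c; third a c] x.
have f_inj : injective f.
  move=> x y /eqP; rewrite /f nth_uniq ?ltn_ord // => [/eqP /val_inj //|].
  by move: ac; clear; case: a c => [[|[|[|//]]] ?] [[|[|[|//]]] ?].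
exists (perm f_inj); rewrite /comb_word /= map_cat map_nseq /= !permE.
by case: odd.
Qed.

Lemma map_comb_word (m : nat) (s : {perm letter}) :
  map s (comb_word m a0 a1) = comb_word m (s a0) (s a1).
Proof.
suff s2 : s a2 = third (s a0) (s a1).
  by rewrite /comb_word /= map_cat map_nseq /=; case: odd; rewrite //= -s2.
have := inj_eq (@perm_inj _ s) a0 a1; have := inj_eq (@perm_inj _ s) a0 a2.
have := inj_eq (@perm_inj _ s) a1 a2.
by case: (s a0) (s a1) (s a2) => [[|[|[|//]]] ?] [[|[|[|//]]] ?]
  [[|[|[|//]]] ?] //= *; apply: val_inj.
Qed.

Lemma word_class_map (s : {perm letter}) (w : word) :
  word_class (map s w) = word_class w.
Proof.
apply/seteqP; split=> v [t ->]; [exists (s * t)%g|exists (s^-1 * t)%g];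
  by rewrite -map_comp; apply: eq_map => x /=; rewrite !permM ?permK.
Qed.

Lemma ParseWords_combs (m : nat) :
  ParseWords (LeftCombTree m.+2) (RightCombTree m.+2) =
  [set word_class (comb_word m a0 a1)].
Proof.
rewrite /LeftCombTree /RightCombTree subSS subSS subn0.
rewrite path_tree_nseqL path_tree_nseqR.
apply/seteqP; split=> [C [w [pl pr ->]]|C ->].
  have [a [c [ac ->]]] := (parses_both_combs m w).1 (conj pl pr).
  by have [s ->] := comb_word_perm m ac; apply: word_class_map.
have [|pl pr] := (parses_both_combs m (comb_word m a0 a1)).2.
  by exists a0, a1.
by exists (comb_word m a0 a1).
Qed.

Theorem theorem4 (n : nat) (hn : 2 <= n) :
  (~~ odd n ->
     ParseWords (LeftCombTree n) (RightCombTree n)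
     = [set word_class (a0 :: nseq (n - 2) a1 ++ [:: a2])])
  /\
  (odd n ->
     ParseWords (LeftCombTree n) (RightCombTree n)
     = [set word_class (a0 :: nseq (n - 2) a1 ++ [:: a0])]).
Proof.
(* With [n = m.+2], the parities of [n] and [m] agree, and [third a0 a1] computes to [a2]. *)
case: n hn => [|[|m]] // _; rewrite ParseWords_combs /comb_word /= !negbK.
by rewrite subSS subSS subn0; split=> [/negbTE|] ->.
Qed.
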